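(* Let $(M,d)$ be a complete multiplicative metric space, let $S\subseteq M$, let $\xi,\eta,\lambda$ be real numbers with $\xi\in[0,1)$ and $\eta,\lambda\in[0,\frac12)$, and let $T:S\to S$ be a function such that for each pair of different points $x,y\in S$ at least one of the following conditions is satisfied: (1) $d(Tx,Ty)\le (d(x,y))^{\xi}$; (2) $d(Tx,Ty)\le \big(d(x,Tx)\cdot d(y,Ty)\big)^{\eta}$; (3) $d(Tx,Ty)\le \big(d(x,Ty)\cdot d(y,Tx)\big)^{\lambda}$. Then, for $x_0\in S$, the sequence $\{T^n(x_0)\}_{n=0}^{\infty}$ converges to a point in $M$, and this point is independent of the choice of $x_0\in S$.
   Context: A multiplicative metric on a nonempty set $X$ is a mapping $d:X\times X\to\mathbb{R}$ such that for all $x,y,z\in X$: $d(x,y)\ge 1$; $d(x,y)=1$ if and only if $x=y$; $d(x,y)=d(y,x)$; and $d(x,z)\le d(x,y)\cdot d(y,z)$. The pair $(X,d)$ is called a multiplicative metric space. A sequence $\{x_n\}$ in $X$ converges (multiplicatively) to $x\in X$ if for every $\epsilon>1$ there is a positive integer $n_0$ with $d(x_n,x)<\epsilon$ for all $n\ge n_0$. It is a multiplicative Cauchy sequence if for every $\epsilon>1$ there is a positive integer $n_0$ with $d(x_n,x_m)<\epsilon$ for all $n,m\ge n_0$. The space $(X,d)$ is complete if every multiplicative Cauchy sequence in $X$ converges (multiplicatively) to a point of $X$. $T^n$ denotes the $n$-fold composition of $T$ with itself ($T^0$ is the identity). *)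

(* Defs.v *)
From HB Require Import structures.
From mathcomp Require Import all_boot all_order all_algebra.
From mathcomp Require Import all_classical all_reals all_analysis.

Set Implicit Arguments.
Unset Strict Implicit.
Unset Printing Implicit Defensive.

Import Order.TTheory GRing.Theory Num.Theory.

Local Open Scope ring_scope.

Record multiplicative_metric (R : realType) (X : Type) (d : X -> X -> R) : Prop := {
  mmetric_nonempty : inhabited X;
  mmetric_ge1 : forall x y, 1 <= d x y;
  mmetric_eq1 : forall x y, d x y = 1 <-> x = y;
  mmetric_sym : forall x y, d x y = d y x;
  mmetric_triangle : forall x y z, d x z <= d x y * d y z
}.

Definition mult_converges (R : realType) (X : Type) (d : X -> X -> R)
    (u : nat -> X) (x : X) : Prop :=
  forall eps : R, 1 < eps ->
    exists2 n0 : nat, (0 < n0)%N &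
      forall n : nat, (n0 <= n)%N -> d (u n) x < eps.

Definition mult_cauchy (R : realType) (X : Type) (d : X -> X -> R)
    (u : nat -> X) : Prop :=
  forall eps : R, 1 < eps ->
    exists2 n0 : nat, (0 < n0)%N &
      forall n m : nat, (n0 <= n)%N -> (n0 <= m)%N -> d (u n) (u m) < eps.

Definition mult_complete (R : realType) (X : Type) (d : X -> X -> R) : Prop :=
  forall u : nat -> X, mult_cauchy d u -> exists x : X, mult_converges d u x.

(* Main.v *)
Require Import Defs.
From HB Require Import structures.
From mathcomp Require Import all_boot all_order all_algebra.
From mathcomp Require Import all_classical all_reals all_analysis.
From mathcomp Require Import lra.

(* Pass to the metric ln d, and put k = max(xi, 2 eta, 2 lambda) < 1.  Each of
   the three conditions gives both
     rho (T x) (T (T x)) <= k rho x (T x)   and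
     rho (T x) (T y) <= k rho x y + rho x (T x) + rho y (T y).
   The second one and the triangle inequality through T x and T y yield
     (1 - k) rho x y <= 2 (rho x (T x) + rho y (T y)),
   while the first makes the right-hand side tend to 0 along iterates.  Thus the
   distance between any two orbits tends to 0: for a single orbit this is the
   Cauchy property, for two orbits it says that they have the same limit. *)

Set Implicit Arguments.
Unset Strict Implicit.
Unset Printing Implicit Defensive.

Import Order.TTheory GRing.Theory Num.Theory.

Local Open Scope classical_set_scope.
Local Open Scope ring_scope.

(** The alternatives are the contraction conditions of Banach, Kannan and Chatterjea. Under [ln] the
    exponents of the multiplicative conditions become factors. *)
Definition zamfirescu (R : realType) (U : Type) (rho : U -> U -> R)
    (xi eta lambda : R) (T : U -> U) : Prop :=
  forall x y, x <> y ->
    [\/ rho (T x) (T y) <= xi * rho x y,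
        rho (T x) (T y) <= eta * (rho x (T x) + rho y (T y))
      | rho (T x) (T y) <= lambda * (rho x (T y) + rho y (T x))].

Section Zamfirescu.
Variables (R : realType) (U : Type) (rho : U -> U -> R).
Hypothesis rho_ge0 : forall x y, 0 <= rho x y.
Hypothesis rho_refl : forall x, rho x x = 0.
Hypothesis rho_sym : forall x y, rho x y = rho y x.
Hypothesis rho_triangle : forall x y z, rho x z <= rho x y + rho y z.
Variables (xi eta lambda k : R) (T : U -> U).
Hypotheses (eta_ge0 : 0 <= eta) (lambda_ge0 : 0 <= lambda).
Hypotheses (xi_le : xi <= k) (eta_le : 2 * eta <= k) (lambda_le : 2 * lambda <= k).
Hypothesis k_lt1 : k < 1.
Hypothesis T_zamfirescu : zamfirescu rho xi eta lambda T.

Lemma zamfirescu_k_ge0 : 0 <= k.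
Proof. by have := eta_ge0; have := eta_le; lra. Qed.

Lemma zamfirescu_step x : rho (T x) (T (T x)) <= k * rho x (T x).
Proof.
have k0 := zamfirescu_k_ge0.
have r0 := rho_ge0 x (T x); have s0 := rho_ge0 (T x) (T (T x)).
have tri := rho_triangle x (T x) (T (T x)).
have [eqx|neqx] := pselect (x = T x).
  by rewrite -!eqx rho_refl mulr0.
(* The unknown distance occurs on both sides. Absorbing it on the left leaves the factor c / (1 -
   c), which is at most k because c (1 + k) <= 2 c <= k. *)
have half c : 0 <= c -> 2 * c <= k ->
    rho (T x) (T (T x)) <= c * (rho x (T x) + rho (T x) (T (T x))) ->
    rho (T x) (T (T x)) <= k * rho x (T x).
  by move=> c0 ck le_c; have := k_lt1; nra.
case: (T_zamfirescu neqx) => [le_xi|/half|le_lambda].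
- by apply: (le_trans le_xi); rewrite ler_wpM2r.
- exact.
(* For the pair x, [T x] one cross term is [rho (T x) (T x)], which vanishes; the other splits by
   the triangle inequality. *)
- apply: (half lambda) => //; apply: (le_trans le_lambda).
  by rewrite rho_refl addr0 ler_wpM2l.
Qed.

Lemma zamfirescu_iter x n :
  rho (iter n T x) (T (iter n T x)) <= k ^+ n * rho x (T x).
Proof.
elim: n => [|n IHn]; first by rewrite expr0 mul1r.
rewrite iterS (le_trans (zamfirescu_step _))// exprS -mulrA.
by rewrite ler_wpM2l ?zamfirescu_k_ge0.
Qed.

Lemma zamfirescu_image x y :
  rho (T x) (T y) <= k * rho x y + rho x (T x) + rho y (T y).
Proof.
have k0 := zamfirescu_k_ge0.
have r0 := rho_ge0 x y; have a0 := rho_ge0 x (T x).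
have b0 := rho_ge0 y (T y).
have [<-|neq] := pselect (x = y).
  by rewrite !rho_refl; nra.
have := k_lt1; have := eta_le; have := lambda_le; move=> lk ek k1.
have kr0 : 0 <= k * rho x y by rewrite mulr_ge0.
have shrink c : 2 * c <= k ->
    c * (rho x (T x) + rho y (T y)) <= rho x (T x) + rho y (T y).
  by move=> ck; rewrite ler_piMl ?addr_ge0//; lra.
case: (T_zamfirescu neq) => le_T; apply: (le_trans le_T).
- by have := ler_wpM2r r0 xi_le; lra.
- by have := shrink _ ek; lra.
(* Routing both cross distances through [rho x y] bounds their sum by 2 [rho x y] + [rho x (T x)] +
   [rho y (T y)], whence the bound 2 [lambda] <= k. *)
- have xTy := rho_triangle x y (T y).
  have yTx := rho_triangle y x (T x); rewrite (rho_sym y x) in yTx.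
  have := ler_wpM2l lambda_ge0 (lerD xTy yTx).
  by have := ler_wpM2r r0 lk; have := shrink _ lk; lra.
Qed.

Lemma zamfirescu_dist x y :
  (1 - k) * rho x y <= 2 * (rho x (T x) + rho y (T y)).
Proof.
have := zamfirescu_image x y; have := rho_triangle x (T x) y.
have := rho_triangle (T x) (T y) y; rewrite (rho_sym (T y) y).
lra.
Qed.

Lemma zamfirescu_orbits x y (e : R) : 0 < e ->
  exists N, forall n m, (N <= n)%N -> (N <= m)%N ->
    rho (iter n T x) (iter m T y) < e.
Proof.
move=> e0; have k0 := zamfirescu_k_ge0.
(* The summand 1 keeps C positive even when x and y are both fixed points, so that 2 C may serve as
   a divisor. *)
pose C := rho x (T x) + rho y (T y) + 1.
have C0 : 0 < C by rewrite ltr_pwDr// addr_ge0.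
have d0 : 0 < (1 - k) * e / (2 * C).
  by rewrite divr_gt0 ?mulr_gt0 ?subr_gt0.
have kcvg : GRing.exp k @ \oo --> (0 : R^o).
  by apply: cvg_expr; rewrite ger0_norm.
have [N _ kN] : \forall n \near \oo, k ^+ n < (1 - k) * e / (2 * C).
  exact: (cvgr_lt _ kcvg).
have kE n : (N <= n)%N -> k ^+ n <= k ^+ N.
  by move=> Nn; rewrite ler_wiXn2l// ltW.
exists N => n m Nn Nm.
have := kN N (leqnn N); rewrite /= ltr_pdivlMr ?mulr_gt0// => kNe.
rewrite -(ltr_pM2l (_ : 0 < 1 - k)) ?subr_gt0//.
apply: (le_lt_trans (zamfirescu_dist _ _)); apply: le_lt_trans kNe.
have := zamfirescu_iter x n; have := zamfirescu_iter y m.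
have := ler_wpM2r (rho_ge0 x (T x)) (kE _ Nn).
have := ler_wpM2r (rho_ge0 y (T y)) (kE _ Nm).
have := exprn_ge0 N k0.
rewrite /C; lra.
Qed.

End Zamfirescu.

Theorem theorem3p3 (R : realType) (M : Type) (d : M -> M -> R)
    (d_metric : multiplicative_metric d) (d_complete : mult_complete d)
    (S : set M) (xi eta lambda : R)
    (xi_bounds : 0 <= xi < 1)
    (eta_bounds : 0 <= eta < 1 / 2)
    (lambda_bounds : 0 <= lambda < 1 / 2)
    (T : set_type S -> set_type S)
    (T_contr : forall x y : set_type S, x <> y ->
      [\/ d (val (T x)) (val (T y)) <= d (val x) (val y) `^ xi,
          d (val (T x)) (val (T y))
            <= (d (val x) (val (T x)) * d (val y) (val (T y))) `^ eta
        | d (val (T x)) (val (T y))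
            <= (d (val x) (val (T y)) * d (val y) (val (T x))) `^ lambda]) :
  exists p : M, forall x0 : set_type S,
    mult_converges d (fun n : nat => val (iter n T x0)) p.
Proof.
have /andP[_ xi1] := xi_bounds.
have /andP[eta0 eta1] := eta_bounds.
have /andP[lambda0 lambda1] := lambda_bounds.
have d_ge1 := mmetric_ge1 d_metric.
have d_gt0 x y : 0 < d x y by exact: lt_le_trans (d_ge1 x y).
pose rho (x y : set_type S) := ln (d (val x) (val y)).
pose k := Num.max xi (Num.max (2 * eta) (2 * lambda)).
have rho_ge0 x y : 0 <= rho x y by exact: ln_ge0.
have rho_refl x : rho x x = 0.
  by rewrite /rho (mmetric_eq1 d_metric _ _).2// ln1.
have rho_sym x y : rho x y = rho y x by rewrite /rho (mmetric_sym d_metric).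
have rho_triangle x y z : rho x z <= rho x y + rho y z.
  by rewrite /rho -lnM ?posrE// ler_ln ?posrE ?mulr_gt0//;
     exact: mmetric_triangle d_metric _ _ _.
(* Since [ln] is increasing on positive reals, each alternative carries over separately. *)
have T_zamfirescu : zamfirescu rho xi eta lambda T.
  move=> x y /T_contr; rewrite /rho -!lnM ?posrE// -!ln_powR.
  by rewrite !ler_ln ?posrE ?powR_gt0 ?mulr_gt0.
have orbits x y (e : R) : 1 < e -> exists N, forall n m, (N <= n)%N ->
    (N <= m)%N -> d (val (iter n T x)) (val (iter m T y)) < e.
  move=> e1; have e0 : 0 < e by exact: lt_trans e1.
  have [|||||N NP] := @zamfirescu_orbits R _ rho rho_ge0 rho_refl rho_sym
    rho_triangle xi eta lambda k T eta0 lambda0 _ _ _ _ T_zamfirescu x y (ln e).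
  - by rewrite /k le_max lexx.
  - by rewrite /k !le_max lexx orbT.
  - by rewrite /k !le_max lexx !orbT.
  - by rewrite /k !gt_max xi1; apply/andP; split; lra.
  - exact: ln_gt0.
  by exists N => n m Nn Nm; have := NP n m Nn Nm; rewrite ltr_ln ?posrE.
(* If S is empty, any point of M will do; otherwise the orbit of a fixed x supplies the limit. *)
have [[x]|noS] := pselect (inhabited (set_type S)); last first.
  by have [p] := mmetric_nonempty d_metric; exists p => x; case: noS.
have [p px] : exists p, mult_converges d (fun n => val (iter n T x)) p.
  apply: d_complete => e /(orbits x x)[N NP].
  (* The successor makes the threshold positive, as the definition of a Cauchy sequence demands. *)
  by exists N.+1 => // n m /ltnW Nn /ltnW Nm; exact: NP.
exists p => y e e1.
have e0 : 0 < e by exact: lt_trans e1.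
(* The multiplicative counterpart of e / 2: the triangle inequality through the n-th iterate of x
   multiplies two such bounds. *)
have s1 : 1 < Num.sqrt e by rewrite -sqrtr1 ltr_sqrt.
have [N NP] := orbits y x _ s1; have [N' N'0 N'P] := px _ s1.
exists (maxn N N'); first by rewrite leq_max N'0 orbT.
move=> n; rewrite geq_max => /andP[Nn N'n].
apply: le_lt_trans (mmetric_triangle d_metric _ (val (iter n T x)) _) _.
rewrite -[ltRHS]sqr_sqrtr ?(ltW e0)// expr2.
by rewrite ltr_pM ?ltW// ?NP ?N'P.
Qed.
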